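(* Let $\mathcal{A}$ and $\mathcal{B}$ be undirected weighted graphs on vertex set $\{1,\dots,n\}$ with real symmetric adjacency matrices $A,B$. Suppose $\mathcal{A}$ is $(\epsilon,\delta)$-friendly, with $A$ normalized so that its spectral radius $\max_i|\lambda_i(A)|$ equals $1$, and suppose $\mathcal{B}$ is $\rho$-isomorphic to $\mathcal{A}$. If $\rho<\frac{\delta^2\epsilon^4}{12 n^{1.5}}$, then RGM and GM are equivalent: the relaxed problem $\min_P \|PA-BP\|_F^2$ subject to $P\mathbf{1}=\mathbf{1}$ has a unique solution $P^\ast$, and its projection $\arg\max_{\Pi\in\mathcal{P}}\mathrm{tr}(\Pi^T P^\ast)$ onto the permutation matrices coincides with the permutation $\Pi^\ast$ satisfying $\mathrm{dis}(\Pi^\ast)\le\rho$ (the global minimizer of GM).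
   Context: $\mathcal{P}$ is the set of $n\times n$ permutation matrices, $\mathbf{1}$ the all-ones vector. For $\Pi\in\mathcal{P}$, $\mathrm{dis}(\Pi)=\|\Pi A-B\Pi\|_F=\|A-\Pi^TB\Pi\|_F$. GM is the problem $\min_{\Pi\in\mathcal{P}}\mathrm{dis}(\Pi)$. Here RGM denotes the procedure: solve the convex quadratic program $\min_P\|PA-BP\|_F^2$ s.t. $P\mathbf{1}=\mathbf{1}$ (over real $n\times n$ matrices, ''pseudo-stochastic'' relaxation), then project the solution onto $\mathcal{P}$ via the linear assignment problem $\arg\max_{\Pi\in\mathcal{P}}\mathrm{tr}(\Pi^TP)$. The graphs are $\rho$-isomorphic if there exists $\Pi^\ast\in\mathcal{P}$ with $\mathrm{dis}(\Pi^\ast)\le\rho$. A graph with symmetric adjacency $A=U\Lambda U^T$ ($U=(u_1,\dots,u_n)$ orthonormal, eigenvalues $\lambda_1,\dots,\lambda_n$) is $(\epsilon,\delta)$-friendly if $\min_{i\neq j}|\lambda_i-\lambda_j|>\delta$ and $\epsilon<|u_i^T\mathbf{1}|<1/\epsilon$ for all $i=1,\dots,n$. *)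

(* Defs.v *)
From mathcomp Require Export all_boot all_order all_algebra.
From mathcomp Require Export classical_sets reals exp.

Set Implicit Arguments.
Unset Strict Implicit.
Unset Printing Implicit Defensive.

Import Order.TTheory GRing.Theory Num.Theory.
Local Open Scope classical_set_scope.
Local Open Scope ring_scope.

(* The set of all solutions, so that [argmin f S = [set x]] says that the
   problem has a solution and that it is unique. *)
Definition argmin (R : realType) (T : Type) (f : T -> R) (S : set T) : set T :=
  [set x | S x /\ forall y, S y -> f x <= f y].

Definition argmax (R : realType) (T : Type) (f : T -> R) (S : set T) : set T :=
  [set x | S x /\ forall y, S y -> f y <= f x].

(* The library's norm on matrices, [`|M|], is the max norm. *)
Definition frobenius (R : realType) (m n : nat) (M : 'M[R]_(m, n)) : R :=
  Num.sqrt (\sum_i \sum_j M i j ^+ 2).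

Definition ones (R : realType) (n : nat) : 'cV[R]_n := const_mx 1.
Arguments ones {R n}.

Definition permutations (R : realType) (n : nat) : set 'M[R]_n :=
  [set Pi | is_perm_mx Pi].
Arguments permutations {R n}.

Definition pseudo_stochastic (R : realType) (n : nat) : set 'M[R]_n :=
  [set P | P *m ones = ones].
Arguments pseudo_stochastic {R n}.

Definition dis (R : realType) (n : nat) (A B Pi : 'M[R]_n) : R :=
  frobenius (Pi *m A - B *m Pi).

Definition gm (R : realType) (n : nat) (A B : 'M[R]_n) : set 'M[R]_n :=
  argmin (dis A B) permutations.

Definition relaxed_gm (R : realType) (n : nat) (A B : 'M[R]_n) : set 'M[R]_n :=
  argmin (fun P => frobenius (P *m A - B *m P) ^+ 2) pseudo_stochastic.

Definition lap_projection (R : realType) (n : nat) (P : 'M[R]_n) :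
    set 'M[R]_n :=
  argmax (fun Pi => \tr (Pi^T *m P)) permutations.

Definition rho_isomorphic (R : realType) (n : nat) (rho : R)
    (A B : 'M[R]_n) : Prop :=
  exists2 Pi, permutations Pi & dis A B Pi <= rho.

(* Column [i] of [U] is the unit eigenvector for the eigenvalue [lam 0 i]. *)
Definition spectral_decomposition (R : realType) (n : nat)
    (A U : 'M[R]_n) (lam : 'rV[R]_n) : Prop :=
  U^T *m U = 1%:M /\ A = U *m diag_mx lam *m U^T.

(* When the eigenvalues are distinct the decomposition is unique up to the
   order and the signs of the eigenvectors, so quantifying it existentially or
   universally gives the same notion. *)
Definition friendly (R : realType) (n : nat) (eps delta : R)
    (A : 'M[R]_n) : Prop :=
  exists (U : 'M[R]_n) (lam : 'rV[R]_n),
    [/\ spectral_decomposition A U lam,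
        forall i j, i != j -> delta < `|lam 0 i - lam 0 j|
      & forall i, eps < `|((col i U)^T *m ones) 0 0| < 1 / eps].

(* Only real eigenvalues are counted, which is all of them when [A] is
   symmetric.  There are finitely many, so [sup] is a maximum as soon as there
   is one; for [n = 0] there is none and the value is 0. *)
Definition spectral_radius (R : realType) (n : nat) (A : 'M[R]_n) : R :=
  sup [set `|a| | a in [set a | eigenvalue A a]].

(* Main.v *)
(** Write [W = Pi^T] for a permutation [Pi] with [dis Pi <= rho],
    [E = Pi A - B Pi], and [D = P - Pi], so that [D 1 = 0].  In the eigenbasis
    of [A] the commutator [D A - A D] has entries [d_ij (lam_j - lam_i)], which
    controls the off-diagonal entries of [D], and [D 1 = 0] expresses the
    diagonal ones through them since [|u_i^T 1| > eps].  Hence [|D|] is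
    bounded by a multiple of [|D A - A D|].  Applied to [W D], with
    [W B Pi = A - W E], this makes [P |-> P A - B P] injective on directions
    [D] with [D 1 = 0] (existence and uniqueness of the relaxed solution), and
    puts every pseudo-stochastic [P] with [dis P <= rho] at distance less than
    1/2 from [Pi].  The relaxed solution is such a [P], because it does at least
    as well as [Pi]; so is any other permutation with [dis <= rho], which then
    equals [Pi] since distinct permutation matrices differ by 1 somewhere. *)

Require Import Defs.
From mathcomp Require Import fingroup perm ring lra.

Set Implicit Arguments.
Unset Strict Implicit.
Unset Printing Implicit Defensive.

Import Order.TTheory GRing.Theory Num.Theory.
Local Open Scope classical_set_scope.
Local Open Scope ring_scope.

(** * Squared Frobenius norm: orthogonal invariance, Cauchy-Schwarz, least squares *)

Section SquaredFrobenius.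
Variable R : realType.
Implicit Types m n p : nat.

Definition sqfrob m n (M : 'M[R]_(m, n)) : R := \sum_i \sum_j M i j ^+ 2.

Lemma sqfrob_ge0 m n (M : 'M[R]_(m, n)) : 0 <= sqfrob M.
Proof. by apply: sumr_ge0 => i _; apply: sumr_ge0 => j _; apply: sqr_ge0. Qed.

Lemma sqfrobE m n (M : 'M[R]_(m, n)) : sqfrob M = frobenius M ^+ 2.
Proof. by rewrite sqr_sqrtr // sqfrob_ge0. Qed.

Lemma frobenius_ge0 m n (M : 'M[R]_(m, n)) : 0 <= frobenius M.
Proof. exact: sqrtr_ge0. Qed.

Lemma sqfrob_mxtrace m n (M : 'M[R]_(m, n)) : sqfrob M = \tr (M *m M^T).
Proof.
by apply: eq_bigr => i _; rewrite mxE; apply: eq_bigr => j _; rewrite mxE expr2.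
Qed.

Lemma sqfrob_tr m n (M : 'M[R]_(m, n)) : sqfrob M^T = sqfrob M.
Proof. by rewrite !sqfrob_mxtrace trmxK mxtrace_mulC. Qed.

Lemma sqfrob_mull m n (V : 'M[R]_m) (M : 'M[R]_(m, n)) :
  V^T *m V = 1%:M -> sqfrob (V *m M) = sqfrob M.
Proof.
move=> VV; rewrite !sqfrob_mxtrace trmx_mul mxtrace_mulC !mulmxA -(mulmxA _ _ V).
by rewrite VV mulmx1 mxtrace_mulC.
Qed.

Lemma sqfrob_mulr m n (V : 'M[R]_n) (M : 'M[R]_(m, n)) :
  V *m V^T = 1%:M -> sqfrob (M *m V) = sqfrob M.
Proof. by move=> VV; rewrite -sqfrob_tr trmx_mul sqfrob_mull ?sqfrob_tr ?trmxK. Qed.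

Lemma sqfrob_entry m n (M : 'M[R]_(m, n)) i j : M i j ^+ 2 <= sqfrob M.
Proof.
rewrite /sqfrob (bigD1 i) //= (bigD1 j) //= -addrA lerDl addr_ge0 //.
  by apply: sumr_ge0 => k _; apply: sqr_ge0.
by apply: sumr_ge0 => k _; apply: sumr_ge0 => l _; apply: sqr_ge0.
Qed.

Lemma sqfrob_eq0 m n (M : 'M[R]_(m, n)) : sqfrob M <= 0 -> M = 0.
Proof.
move=> M0; apply/matrixP => i j; rewrite mxE; apply/eqP.
by rewrite -sqrf_eq0 eq_le sqr_ge0 andbT (le_trans (sqfrob_entry _ i j)).
Qed.

Lemma sqfrob0 m n : sqfrob (0 : 'M[R]_(m, n)) = 0.
Proof. by rewrite sqfrob_mxtrace mul0mx mxtrace0. Qed.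

Lemma sqfrobN m n (M : 'M[R]_(m, n)) : sqfrob (- M) = sqfrob M.
Proof. by rewrite !sqfrob_mxtrace linearN mulNmx mulmxN opprK. Qed.

Lemma sqfrobD m n (M N : 'M[R]_(m, n)) :
  sqfrob (M + N) = sqfrob M + sqfrob N + 2 * \tr (M *m N^T).
Proof.
rewrite !sqfrob_mxtrace linearD mulmxDl !mulmxDr !mxtraceD.
rewrite -[\tr (N *m M^T)]mxtrace_tr trmx_mul trmxK; ring.
Qed.

Lemma sqfrob_sub3 m n (X Y Z : 'M[R]_(m, n)) :
  sqfrob (X - Y - Z) <= 3 * (sqfrob X + sqfrob Y + sqfrob Z).
Proof.
rewrite /sqfrob -!big_split mulr_sumr ler_sum // => i _.
rewrite -!big_split mulr_sumr ler_sum // => j _; rewrite !mxE /=.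
(* Entrywise, the right side minus the left is [(x + y)^2 + (x + z)^2 + (y - z)^2]. *)
have := sqr_ge0 (X i j + Y i j); have := sqr_ge0 (X i j + Z i j).
have := sqr_ge0 (Y i j - Z i j); nra.
Qed.

(** Lagrange's identity: the double sum of [(a i * b j - a j * b i) ^+ 2] is twice the gap between
    the two sides. *)
Lemma cauchy_schwarz_sum (I : finType) (P : pred I) (a b : I -> R) :
  (\sum_(i | P i) a i * b i) ^+ 2 <=
  (\sum_(i | P i) a i ^+ 2) * (\sum_(i | P i) b i ^+ 2).
Proof.
have : 0 <= \sum_(i | P i) \sum_(j | P j) (a i * b j - a j * b i) ^+ 2.
  by apply: sumr_ge0 => i _; apply: sumr_ge0 => j _; apply: sqr_ge0.
set A := \sum_(i | P i) a i ^+ 2; set B := \sum_(i | P i) b i ^+ 2.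
set C := \sum_(i | P i) a i * b i.
suff -> : \sum_(i | P i) \sum_(j | P j) (a i * b j - a j * b i) ^+ 2
    = 2 * (A * B - C ^+ 2) by lra.
transitivity (\sum_(i | P i) (a i ^+ 2 * B + b i ^+ 2 * A - (a i * b i) * (2 * C))).
  apply: eq_bigr => i _; rewrite !mulr_sumr -big_split -sumrB /=.
  by apply: eq_bigr => j _; ring.
rewrite sumrB big_split -!mulr_suml /= -/A -/B -/C; ring.
Qed.

Lemma sqfrobM m n p (M : 'M[R]_(m, n)) (N : 'M[R]_(n, p)) :
  sqfrob (M *m N) <= sqfrob M * sqfrob N.
Proof.
rewrite -[sqfrob N]sqfrob_tr /sqfrob mulr_suml ler_sum // => i _.
rewrite mulr_sumr ler_sum // => j _; rewrite mxE.
under [X in _ * X]eq_bigr do rewrite mxE.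
exact: cauchy_schwarz_sum.
Qed.

(* The normal equations are always solvable: [M M^T C = 0] forces [M^T C = 0]. *)
Lemma least_squares m n (M : 'M[R]_(m, n)) (y : 'rV[R]_n) :
  exists x : 'rV[R]_m, forall z, sqfrob (y + x *m M) <= sqfrob (y + z *m M).
Proof.
have MTM : (M^T <= M *m M^T)%MS.
  rewrite submxE; apply/eqP/sqfrob_eq0.
  rewrite -sqfrob_tr sqfrob_mxtrace trmxK trmx_mul trmxK -!mulmxA.
  by rewrite (mulmxA M) mulmx_coker mulmx0 mxtrace0.
have /submxP[x xE] := submx_trans (submxMl y M^T) MTM.
exists (- x) => z.
(* As [y *m M^T = x *m (M *m M^T)], the residual [y - x *m M] is orthogonal to the rows of [M], and
   Pythagoras applies. *)
have -> : y + z *m M = (y + - x *m M) + (z + x) *m M.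
  by rewrite mulmxDl mulNmx addrACA addNr addr0.
rewrite [leRHS]sqfrobD trmx_mul mulmxA; move: (z + x) => w.
rewrite mulmxDl -(mulmxA (- x)) [- x *m (_ *m _)]mulNmx -xE subrr.
by rewrite mul0mx mxtrace0 mulr0 addr0 lerDl sqfrob_ge0.
Qed.

End SquaredFrobenius.

(** * Commutators with a friendly matrix, and the numerical bound on [rho] *)

Section Friendly.
Variable R : realType.

(** Row by row, with [o] the off-diagonal mass: the gaps bound [delta^2 o] by the commutator's row,
    while [D c = 0] and Cauchy-Schwarz bound [eps^2 d_ii^2] by [|c|^2 o]. *)
Lemma diag_commutator_stability n (eps delta : R) (lam : 'rV[R]_n)
    (c : 'cV[R]_n) (D : 'M[R]_n) :
  0 < eps -> 0 < delta ->
  (forall i j, i != j -> delta < `|lam 0 i - lam 0 j|) ->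
  (forall i, eps < `|c i 0|) ->
  D *m c = 0 ->
  delta ^+ 2 * eps ^+ 2 * sqfrob D <=
  (eps ^+ 2 + sqfrob c) * sqfrob (D *m diag_mx lam - diag_mx lam *m D).
Proof.
move=> eps0 delta0 gap cgt Dc0; rewrite /sqfrob !mulr_sumr ler_sum // => i _.
have cE : sqfrob c = \sum_j c j 0 ^+ 2.
  by apply: eq_bigr => j _; rewrite big_ord1.
rewrite -/(sqfrob c); set s := sqfrob c in cE *.
have s0 : 0 <= s by apply: sqfrob_ge0.
set o := \sum_(j | j != i) D i j ^+ 2.
have o0 : 0 <= o by apply: sumr_ge0 => j _; apply: sqr_ge0.
have comm_ge : delta ^+ 2 * o <=
    \sum_j (D *m diag_mx lam - diag_mx lam *m D) i j ^+ 2.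
  rewrite (bigD1 i) //= ler_wpDl ?sqr_ge0 // mulr_sumr ler_sum // => j ji.
  rewrite mul_mx_diag mul_diag_mx !mxE.
  have -> : D i j * lam 0 j - lam 0 i * D i j = (lam 0 j - lam 0 i) * D i j.
    by ring.
  rewrite exprMn ler_wpM2r ?sqr_ge0 // -[leRHS]real_normK ?num_real //.
  by rewrite lerXn2r ?nnegrE ?normr_ge0 ?(ltW delta0) // ltW // gap.
have diag_le : eps ^+ 2 * D i i ^+ 2 <= s * o.
  have rowi : D i i * c i 0 = - \sum_(j | j != i) D i j * c j 0.
    move/matrixP/(_ i 0): Dc0; rewrite !mxE (bigD1 i) //=.
    by move/eqP; rewrite addr_eq0 => /eqP.
  apply: (@le_trans _ _ ((D i i * c i 0) ^+ 2)).
    rewrite exprMn mulrC ler_wpM2l ?sqr_ge0 // -[leRHS]real_normK ?num_real //.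
    by rewrite lerXn2r ?nnegrE ?normr_ge0 ?(ltW eps0) // ltW.
  rewrite rowi sqrrN (le_trans (cauchy_schwarz_sum _ _ _)) // mulrC.
  by rewrite ler_wpM2r // cE [leRHS](bigD1 i) //= lerDr sqr_ge0.
rewrite (bigD1 i) //= -/o.
have := ler_wpM2l (sqr_ge0 delta) diag_le.
have es0 : 0 <= eps ^+ 2 + s by rewrite addr_ge0 ?sqr_ge0.
have := ler_wpM2l es0 comm_ge.
nra.
Qed.

Lemma sqfrob_ones n : sqfrob (ones : 'cV[R]_n) = n%:R.
Proof.
rewrite /sqfrob; under eq_bigr do rewrite big_ord1 mxE expr1n.
by rewrite sumr_const card_ord.
Qed.

(** Conjugation by [U] preserves the norm and reduces to the diagonal case with [c = U^T 1], where
    [|c|^2 = n]. *)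
Lemma commutator_stability n (eps delta : R) (A D : 'M[R]_n) :
  0 < eps -> 0 < delta -> friendly eps delta A -> D *m ones = 0 ->
  delta ^+ 2 * eps ^+ 2 * sqfrob D <=
  (eps ^+ 2 + n%:R) * sqfrob (D *m A - A *m D).
Proof.
move=> eps0 delta0 [U [lam [[UU AE] gap ceps]]] D1.
have UU' := mulmx1C UU.
have c_gt i : eps < `|(U^T *m ones) i 0|.
  have /andP[+ _] := ceps i.
  by rewrite tr_col -row_mul mxE.
have Dc : (U^T *m D *m U) *m (U^T *m ones) = 0.
  by rewrite -!mulmxA [U *m _]mulmxA UU' mul1mx D1 mulmx0.
have := diag_commutator_stability eps0 delta0 gap c_gt Dc.
rewrite (sqfrob_mull ones) ?trmxK // sqfrob_ones.
rewrite sqfrob_mulr // sqfrob_mull ?trmxK //.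
suff -> : U^T *m D *m U *m diag_mx lam - diag_mx lam *m (U^T *m D *m U)
    = U^T *m (D *m A - A *m D) *m U.
  by rewrite sqfrob_mulr // sqfrob_mull ?trmxK.
rewrite AE mulmxBr mulmxBl !mulmxA; congr (_ - _).
  by rewrite -[RHS]mulmxA UU mulmx1.
by rewrite UU mul1mx.
Qed.

Lemma spectral_radius_ge n (A U : 'M[R]_n) (lam : 'rV[R]_n) i :
  spectral_decomposition A U lam -> `|lam 0 i| <= spectral_radius A.
Proof.
move=> [UU AE]; have UU' := mulmx1C UU.
have UA : U^T *m A = diag_mx lam *m U^T.
  by rewrite AE !mulmxA UU mul1mx.
have AU : A *m U = U *m diag_mx lam.
  by rewrite AE -mulmxA UU mulmx1.
apply: sup_ubound; last first.
  exists (lam 0 i) => //=; apply/eigenvalueP; exists (row i U^T).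
    rewrite -row_mul UA; apply/rowP => j.
    by rewrite mul_diag_mx !mxE.
  apply: contra_neq (oner_neq0 R) => r0.
  have /(congr1 (row i)) := UU; rewrite row_mul r0 mul0mx.
  by move/rowP/(_ i); rewrite !mxE eqxx.
(* Every eigenvalue is some [lam 0 j], so this sum bounds the set above, as [sup] requires. *)
exists (\sum_j `|lam 0 j|) => _ [a /eigenvalueP[v vA v0] <-].
have wE : v *m U *m diag_mx lam = a *: (v *m U).
  by rewrite -mulmxA -AU mulmxA vA scalemxAl.
have /rV0Pn[j wj] : v *m U != 0.
  apply: contra_neq v0 => w0.
  by rewrite -[v]mulmx1 -UU' mulmxA w0 mul0mx.
have -> : a = lam 0 j.
  move/rowP/(_ j): wE; rewrite mul_mx_diag [LHS]mxE [RHS]mxE mulrC.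
  by move/(mulIf wj).
by rewrite (bigD1 j) //= lerDl sumr_ge0.
Qed.

(** Squaring gives [144 n^3 rho^2 <= delta^4 eps^8]. Then [delta^2 <= 4], [eps <= 1] and
    [n^3 >= 4 n] leave [144 n rho^2 <= delta^2 eps^2], and [eps^2 <= n] finishes. *)
Lemma rho_bound n (eps delta rho : R) :
  (1 < n)%N -> 0 < eps -> eps <= 1 -> 0 < delta -> delta <= 2 -> 0 <= rho ->
  rho < delta ^+ 2 * eps ^+ 4 / (12 * n%:R `^ (3 / 2)) ->
  72 * (eps ^+ 2 + n%:R) * rho ^+ 2 <= delta ^+ 2 * eps ^+ 2.
Proof.
move=> n1 eps0 eps1 delta0 delta2 rho0.
have N2 : 2 <= n%:R :> R by rewrite ler_nat.
have N0 : 0 < n%:R :> R by lra.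
move: (n%:R : R) N2 N0 => N N2 N0.
set s := N `^ (3 / 2).
have s0 : 0 < s by apply: powR_gt0.
have sE : s ^+ 2 = N ^+ 3.
  rewrite -powR_mulrn ?(ltW s0) // -powRrM divfK ?pnatr_eq0 //.
  by rewrite powR_mulrn // ltW.
rewrite ltr_pdivlMr ?mulr_gt0 // => small.
have sq : 144 * N ^+ 3 * rho ^+ 2 <= delta ^+ 4 * eps ^+ 8.
  have -> : 144 * N ^+ 3 * rho ^+ 2 = (rho * (12 * s)) ^+ 2.
    by rewrite -sE; ring.
  have -> : delta ^+ 4 * eps ^+ 8 = (delta ^+ 2 * eps ^+ 4) ^+ 2 by ring.
  rewrite lerXn2r ?nnegrE ?(ltW small) //.
    by rewrite !mulr_ge0 // ltW.
  by rewrite mulr_ge0 ?exprn_ge0 // ltW.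
have d4 : delta ^+ 2 <= 4 by nra.
have e1 : eps ^+ 2 <= 1 by rewrite expr_le1 // ltW.
have e8 : eps ^+ 8 <= eps ^+ 2.
  by rewrite ler_wiXn2l // ltW.
have de : delta ^+ 4 * eps ^+ 8 <= 4 * (delta ^+ 2 * eps ^+ 2).
  have -> : delta ^+ 4 * eps ^+ 8 = delta ^+ 2 * (delta ^+ 2 * eps ^+ 8) by ring.
  apply: ler_pM => //; rewrite ?mulr_ge0 ?exprn_ge0 ?(ltW delta0) ?(ltW eps0) //.
  by rewrite ler_wpM2l ?sqr_ge0.
have r0 := sqr_ge0 rho.
have nr : 4 * (N * rho ^+ 2) <= N ^+ 3 * rho ^+ 2.
  rewrite mulrA ler_wpM2r // exprS mulrC ler_pM2l //; nra.
have er : eps ^+ 2 * rho ^+ 2 <= N * rho ^+ 2.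
  by rewrite ler_wpM2r //; lra.
nra.
Qed.
End Friendly.

(** * Permutation matrices and the linear assignment projection *)

Section Permutations.
Variables (R : realType) (n : nat).
Implicit Types (s : 'S_n) (A B P Q D : 'M[R]_n).

Lemma mul_tr_perm_mx s : (perm_mx s)^T *m perm_mx s = 1%:M :> 'M[R]_n.
Proof. by rewrite tr_perm_mx -perm_mxM mulVg perm_mx1. Qed.

Lemma perm_mx_ones s : perm_mx s *m ones = ones :> 'cV[R]_n.
Proof. by rewrite -row_permE; apply/matrixP => i j; rewrite !mxE. Qed.

Lemma mxtrace_tr_perm_mul s Q :
  \tr ((perm_mx s)^T *m Q) = \sum_i Q i (s i).
Proof.
rewrite mxtrace_mulC; apply: eq_bigr => i _; rewrite mxE (bigD1 (s i)) //=.
rewrite !mxE eqxx mulr1 big1 ?addr0 // => j.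
by rewrite !mxE eq_sym => /negPf->; rewrite mulr0.
Qed.

(** Entries of [Q] are within 1/2 of those of [perm_mx s], so in row [i] the entry at [s i] strictly
    exceeds all others: a different permutation loses in some row and gains in none. *)
Lemma lap_projection_close s Q :
  sqfrob (Q - perm_mx s) < 4^-1 -> lap_projection Q = [set perm_mx s].
Proof.
move=> close.
have entry i j : `|Q i j - (s i == j)%:R| < 2^-1.
  have := le_lt_trans (sqfrob_entry (Q - perm_mx s) i j) close.
  rewrite !mxE -real_normK ?num_real // => lt4.
  rewrite -(@ltr_pXn2r _ 2) ?nnegrE ?invr_ge0 // (lt_le_trans lt4) //; lra.
have lt_tr (t : 'S_n) : t != s ->
    \tr ((perm_mx t)^T *m Q) < \tr ((perm_mx s)^T *m Q).
  move=> ts; rewrite !mxtrace_tr_perm_mul.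
  have lt_entry i : t i != s i -> Q i (t i) < Q i (s i).
    move=> tsi; have := entry i (t i); have := entry i (s i).
    rewrite eqxx eq_sym (negPf tsi) mulr1n mulr0n !ltr_norml => /andP[+ _] /andP[_ +].
    lra.
  have [i tsi] : exists i, t i != s i.
    apply/existsP; apply: contraNT ts; rewrite negb_exists => /forallP ts.
    by apply/eqP/permP => i; apply/eqP; rewrite -[_ == _]negbK.
  rewrite (bigD1 i) //= [ltRHS](bigD1 i) //= ltr_leD ?lt_entry // ler_sum // => j _.
  by have [->//|tsj] := eqVneq (t j) (s j); rewrite ltW ?lt_entry.
apply/seteqP; split=> [P [/is_perm_mxP[t ->] maxP]|_ ->]; last first.
  split; first exact: perm_mx_is_perm.
  move=> _ /is_perm_mxP[t ->].
  by have [->//|ts] := eqVneq t s; rewrite ltW ?lt_tr.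
have [->//|ts] := eqVneq t s.
have := maxP _ (perm_mx_is_perm R s).
by rewrite leNgt lt_tr.
Qed.

Lemma perm_mx_close s t :
  sqfrob (perm_mx t - perm_mx s : 'M[R]_n) < 4^-1 -> t = s.
Proof.
move=> close; apply/permP => i; apply/eqP; apply: contraTT close => tsi.
rewrite -leNgt (le_trans _ (sqfrob_entry _ i (t i))) //.
rewrite !mxE eqxx eq_sym (negPf tsi) subr0 expr1n; lra.
Qed.

(** * Existence and uniqueness of the relaxed solution *)

Lemma sqfrob_mxvec p q (M : 'M[R]_(p, q)) : sqfrob (mxvec M) = sqfrob M.
Proof.
rewrite /sqfrob big_ord1 pair_bigA /=.
rewrite (reindex _ (curry_mxvec_bij p q)) /=.
by apply: eq_bigr => -[i j] _ /=; rewrite mxvecE.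
Qed.

(** The feasible set is the affine space of all [P + D *m kermx ones]; vectorizing [D] gives an
    unconstrained least-squares problem. *)
Lemma relaxed_gm_neq0 A B P :
  pseudo_stochastic P -> exists Q, relaxed_gm A B Q.
Proof.
move=> P1; pose f : 'M[R]_n -> 'M[R]_n :=
  (mulmxr A \- mulmx B) \o mulmxr (kermx ones).
have [x xmin] := least_squares (lin_mx f) (mxvec (P *m A - B *m P)).
have valE z : sqfrob (mxvec (P *m A - B *m P) + z *m lin_mx f) =
    frobenius ((P + vec_mx z *m kermx ones) *m A -
               B *m (P + vec_mx z *m kermx ones)) ^+ 2.
  rewrite -[z in LHS]vec_mxK mul_vec_lin -linearD sqfrob_mxvec -sqfrobE /f /=.
  by rewrite mulmxDl mulmxDr opprD addrACA.
exists (P + vec_mx x *m kermx ones); split.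
  by rewrite /pseudo_stochastic /= mulmxDl -mulmxA mulmx_ker mulmx0 addr0.
move=> Q Q1; rewrite -valE.
have /submxP[D DE] : (Q - P <= kermx (ones : 'cV[R]_n))%MS.
  by apply/sub_kermxP; rewrite mulmxBl Q1 P1 subrr.
have -> : Q = P + vec_mx (mxvec D) *m kermx ones.
  by rewrite mxvecK -DE addrC subrK.
by rewrite -valE.
Qed.

(* A strictly convex quadratic cannot have two minimizers: by the parallelogram
   law their midpoint would do better. *)
Lemma relaxed_gm_unique A B P Q :
  (forall D, D *m ones = 0 -> D *m A = B *m D -> D = 0) ->
  relaxed_gm A B P -> relaxed_gm A B Q -> P = Q.
Proof.
move=> inj [P1 Pmin] [Q1 Qmin].
have PQ := Pmin _ Q1; have QP := Qmin _ P1.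
have mid1 : pseudo_stochastic (2^-1 *: (P + Q)).
  rewrite /pseudo_stochastic /= -scalemxAl mulmxDl P1 Q1 -mulr2n -scaler_nat.
  by rewrite scalerA mulVf ?scale1r // pnatr_eq0.
have := Pmin _ mid1; move: PQ QP; rewrite -!sqfrobE.
have -> : 2^-1 *: (P + Q) *m A - B *m (2^-1 *: (P + Q)) =
    2^-1 *: ((P *m A - B *m P) + (Q *m A - B *m Q)).
  by rewrite -scalemxAl -scalemxAr -scalerBr mulmxDl mulmxDr opprD addrACA.
set X := P *m A - B *m P; set Y := Q *m A - B *m Q => XY YX.
have -> : sqfrob (2^-1 *: (X + Y)) = 4^-1 * sqfrob (X + Y).
  rewrite !sqfrob_mxtrace linearZ /= -scalemxAl -scalemxAr !mxtraceZ mulrA.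
  by congr (_ * _); field.
have := sqfrobD X (- Y); rewrite sqfrobN linearN mulmxN [\tr (- _)]raddfN.
rewrite [sqfrob (X + Y)]sqfrobD => par mid.
(* Minimality gives [|X|^2 = |Y|^2] and, at the midpoint, [|X + Y|^2 >= 4 |X|^2]. *)
have /sqfrob_eq0 XY0 : sqfrob (X - Y) <= 0 by lra.
apply/eqP; rewrite -subr_eq0; apply/eqP/inj.
  by rewrite mulmxBl P1 Q1 subrr.
apply/eqP; rewrite -subr_eq0 mulmxBl mulmxBr opprB addrACA [- _ + _]addrC.
by rewrite -XY0 /X /Y opprB addrACA.
Qed.

(** * Stability of the map [D |-> D A - B D] on directions with [D 1 = 0] *)

(** With [W] and [E] as above, [W D A - A W D = W (D A - B D - E W D)], and the orthogonal factor
    [W] drops out of both norms. *)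
Lemma perturbed_stability s (eps delta : R) A B D :
  0 < eps -> 0 < delta -> friendly eps delta A -> D *m ones = 0 ->
  delta ^+ 2 * eps ^+ 2 * sqfrob D <=
  (eps ^+ 2 + n%:R) * sqfrob (D *m A - B *m D -
    (perm_mx s *m A - B *m perm_mx s) *m ((perm_mx s)^T *m D)).
Proof.
move=> eps0 delta0 frA D1; have WP := mul_tr_perm_mx s; have PW := mulmx1C WP.
have WD1 : ((perm_mx s)^T *m D) *m ones = 0 by rewrite -mulmxA D1 mulmx0.
have := commutator_stability eps0 delta0 frA WD1.
rewrite sqfrob_mull ?trmxK //.
suff -> : (perm_mx s)^T *m D *m A - A *m ((perm_mx s)^T *m D) =
    (perm_mx s)^T *m (D *m A - B *m D -
    (perm_mx s *m A - B *m perm_mx s) *m ((perm_mx s)^T *m D)).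
  by rewrite sqfrob_mull ?trmxK.
rewrite mulmxBl -(mulmxA B) !mulmxA.
rewrite -(mulmxA B (perm_mx s)) PW mulmx1 opprB addrA subrK mulmxBr !mulmxA.
by rewrite WP mul1mx.
Qed.

(** Covers the sizes where no pair of eigenvalues is available to bound [delta]. *)
Lemma mul_ones_eq0 D : (n <= 1)%N -> D *m ones = 0 -> D = 0.
Proof.
move=> n1 D1.
have val0 (k : 'I_n) : k = 0 :> nat.
  by case: k => -[|k] //= /leq_trans/(_ n1).
apply/matrixP => i j; move/matrixP/(_ i 0): D1.
rewrite !mxE (bigD1 j) //= mxE mulr1 big1 ?addr0 // => k /eqP[].
by apply/val_inj; rewrite /= !val0.
Qed.

(** Used with [c = 0] for injectivity and with [c = 1] for closeness to [perm_mx s]. Keeping [X] and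
    [Y] apart lets one three-term inequality treat them together with the perturbation [E W D]. *)
Lemma stability s (eps delta rho : R) A B D X Y (c : R) :
  0 < eps -> 0 < delta -> friendly eps delta A -> spectral_radius A = 1 ->
  dis A B (perm_mx s) <= rho ->
  rho < delta ^+ 2 * eps ^+ 4 / (12 * n%:R `^ (3 / 2)) ->
  D *m ones = 0 -> D *m A - B *m D = X - Y -> 0 <= c ->
  sqfrob X <= c * rho ^+ 2 -> sqfrob Y <= c * rho ^+ 2 ->
  23 * sqfrob D <= 2 * c.
Proof.
move=> eps0 delta0 frA radA disE rho_small D1 DE c0 Xc Yc.
have [n1|n1] := leqP n 1.
  by rewrite (mul_ones_eq0 n1 D1) sqfrob0 mulr0 mulr_ge0.
have rho0 : 0 <= rho := le_trans (frobenius_ge0 _) disE.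
have [U [lam [dec gap ceps]]] := frA.
pose i0 := Ordinal (ltnW n1); pose i1 := Ordinal n1.
(* Two eigenvalues in [[-1, 1]] are at most 2 apart. *)
have delta2 : delta <= 2.
  have := gap i0 i1 isT; have := ler_normB (lam 0 i0) (lam 0 i1).
  have := spectral_radius_ge i0 dec; have := spectral_radius_ge i1 dec.
  by rewrite radA; lra.
have eps1 : eps <= 1.
  have /andP[lt1 lt2] := ceps i0; have := lt_trans lt1 lt2.
  by rewrite ltr_pdivlMr // -expr2 => /ltW; rewrite expr_le1 // ltW.
have small := rho_bound n1 eps0 eps1 delta0 delta2 rho0 rho_small.
have := perturbed_stability s B eps0 delta0 frA D1.
rewrite DE; set E := perm_mx s *m A - B *m perm_mx s.
have Ele : sqfrob E <= rho ^+ 2.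
  by rewrite sqfrobE lerXn2r ?nnegrE ?frobenius_ge0.
have Zle : sqfrob (E *m ((perm_mx s)^T *m D)) <= rho ^+ 2 * sqfrob D.
  apply: le_trans (sqfrobM _ _) _; rewrite sqfrob_mull ?trmxK.
    by rewrite ler_wpM2r ?sqfrob_ge0.
  exact/mulmx1C/mul_tr_perm_mx.
have K0 : 0 <= eps ^+ 2 + n%:R by rewrite addr_ge0 ?sqr_ge0.
have k0 : 0 < delta ^+ 2 * eps ^+ 2 by rewrite mulr_gt0 ?exprn_gt0.
have d0 := sqfrob_ge0 D.
move: (sqfrob D) (_ + n%:R) (delta ^+ 2 * _) d0 K0 k0 small Zle
  => d K k d0 K0 k0 small Zle kd.
have lt3 : sqfrob (X - Y - E *m ((perm_mx s)^T *m D)) <=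
    3 * ((2 * c + d) * rho ^+ 2).
  by apply: le_trans (sqfrob_sub3 _ _ _) _; lra.
have {}kd := le_trans kd (ler_wpM2l K0 lt3).
have cd0 : 0 <= 2 * c + d by lra.
(* As [72 = 3 * 24], the bound on [rho] absorbs the factor 3; the [d] on the right is then moved
   left, leaving 23. *)
have : k * (24 * d) <= k * (2 * c + d).
  have := ler_wpM2l cd0 small; lra.
by rewrite ler_pM2l //; lra.
Qed.

End Permutations.

(** * Equivalence of the relaxation and graph matching *)

Theorem theorem2 (R : realType) (n : nat) (A B : 'M[R]_n)
    (eps delta rho : R)
    (symA : A^T = A) (symB : B^T = B)
    (eps_gt0 : 0 < eps) (delta_gt0 : 0 < delta)
    (friendlyA : friendly eps delta A)
    (radiusA : spectral_radius A = 1)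
    (isoAB : rho_isomorphic rho A B)
    (rho_small : rho < delta ^+ 2 * eps ^+ 4 / (12 * n%:R `^ (3 / 2))) :
  exists Pstar Pistar : 'M[R]_n,
    [/\ relaxed_gm A B = [set Pstar],
        lap_projection Pstar = [set Pistar],
        permutations `&` [set Pi | dis A B Pi <= rho] = [set Pistar]
      & gm A B = [set Pistar]].
Proof.
have [Pi /is_perm_mxP[s ->] disE] := isoAB.
have rho0 : 0 <= rho := le_trans (frobenius_ge0 _) disE.
have dis_sq Q : dis A B Q <= rho -> sqfrob (Q *m A - B *m Q) <= rho ^+ 2.
  by move=> ?; rewrite sqfrobE lerXn2r ?nnegrE ?frobenius_ge0.
have inj D : D *m ones = 0 -> D *m A = B *m D -> D = 0.
  move=> D1 DAB; apply: sqfrob_eq0.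
  have DE : D *m A - B *m D = 0 - 0 by rewrite DAB !subrr.
  have := stability eps_gt0 delta_gt0 friendlyA radiusA disE rho_small D1 DE.
  by move=> /(_ 0); rewrite !sqfrob0 mul0r mulr0 pmulr_rle0 //; apply.
have close Q : pseudo_stochastic Q -> dis A B Q <= rho ->
    sqfrob (Q - perm_mx s) < 4^-1.
  move=> Q1 /dis_sq QE.
  have D1 : (Q - perm_mx s) *m ones = 0 by rewrite mulmxBl Q1 perm_mx_ones subrr.
  have DE : (Q - perm_mx s) *m A - B *m (Q - perm_mx s) =
      (Q *m A - B *m Q) - (perm_mx s *m A - B *m perm_mx s).
    rewrite mulmxBl mulmxBr !opprB addrACA [RHS]addrACA; congr (_ + _).
    exact: addrC.
  have := stability eps_gt0 delta_gt0 friendlyA radiusA disE rho_small D1 DE.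
  (* The squared distance is at most [2 / 23 < 1 / 4]. *)
  move=> /(_ 1); rewrite mul1r => /(_ ler01 QE (dis_sq _ disE)); lra.
have ps1 : pseudo_stochastic (perm_mx s : 'M[R]_n) := perm_mx_ones R s.
have [P Pmin] := relaxed_gm_neq0 A B ps1.
have iso_unique t : dis A B (perm_mx t) <= rho -> t = s.
  by move=> /(close _ (perm_mx_ones R t)) /perm_mx_close.
exists P, (perm_mx s); split.
- apply/seteqP; split=> [Q Qmin|_ ->//].
  exact: relaxed_gm_unique Qmin Pmin.
- case: Pmin => P1 /(_ _ ps1) Ple.
  apply/lap_projection_close/close => //; apply: le_trans disE.
  (* The relaxed objective is the square of [dis], so minimality against [perm_mx s] bounds
     [dis A B P] itself. *)
  by rewrite -(@ler_pXn2r _ 2) ?nnegrE ?frobenius_ge0.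
- apply/seteqP; split=> [_ [/is_perm_mxP[t ->] /= /iso_unique->]//|_ ->].
  by split=> //; exact: perm_mx_is_perm.
- apply/seteqP; split=> [_ [/is_perm_mxP[t ->] tmin]|_ ->].
    rewrite (iso_unique t) //; apply: le_trans disE.
    exact/tmin/perm_mx_is_perm.
  split=> [|_ /is_perm_mxP[t ->]]; first exact: perm_mx_is_perm.
  have [/iso_unique->//|lt_rho] := leP (dis A B (perm_mx t)) rho.
  exact: le_trans disE (ltW lt_rho).
Qed.
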